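(* Let $I$ be a yes-instance of \textsc{Stars NWS}. Then for every optimal solution $G'=(V,E')$ of $I$ there is an edge set $E^*\subseteq E'$ with $|E^*|\le 4t$ such that the edge set of every local cycle of $G'$ is a subset of $E^*$.
   Context: \textsc{Stars NWS}: given a graph $G=(V,E)$ with $n$ vertices, a collection $\mathcal{C}$ of subsets of $V$ (communities), $\omega:E\to\mathbb{R}_+$, an integer $\ell$ and a positive real $b$, a solution is a spanning subgraph $G'=(V,E')$ with $E'\subseteq E$, $|E'|\le\ell$, $\omega(E')\le b$, such that for each $C\in\mathcal{C}$ the set $\mathrm{univ}_{G'}(C)$ of vertices $u\in C$ adjacent in $G'$ to all of $C\setminus\{u\}$ is nonempty. An optimal solution is a solution with the minimum number of edges. The parameter is $t=\ell-n+x$ where $x$ is the number of connected components of the hypergraph $(V,\mathcal{C})$. Two distinct communities $C_1,C_2$ induce a local cycle in $G'$ if there are $c_i\in\mathrm{univ}_{G'}(C_i)$ ($i=1,2$) such that the graph on $C_1\cup C_2$ with edge set $\{\{c_i,w\}: w\in C_i\setminus\{c_i\}, i\in\{1,2\}\}$ contains a cycle; each cycle of this graph is a local cycle of $G'$. *)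

(* Defs.v *)
From HB Require Import structures.
From mathcomp Require Import all_boot all_order all_algebra.
From mathcomp Require Import reals.

Set Implicit Arguments.
Unset Strict Implicit.
Unset Printing Implicit Defensive.

Import Order.TTheory GRing.Theory Num.Theory.

Local Open Scope ring_scope.

Section EdgeSets.

Variable V : finType.

(* The edge set of a simple graph on V is a set of two-element sets; spanning
   subgraphs are identified with their edge sets. *)
Definition adj (F : {set {set V}}) : rel V :=
  fun u v => (u != v) && ([set u; v] \in F).

Definition univ (F : {set {set V}}) (C : {set V}) : {set V} :=
  [set u in C | [forall w in C :\ u, adj F u w]].

Definition star (c : V) (C : {set V}) : {set {set V}} :=
  [set [set c; w] | w in C :\ c].

(* A cycle is given by the cyclic sequence of its pairwise distinct vertices. *)
Definition is_cycle (F : {set {set V}}) (p : seq V) : Prop :=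
  (2 < size p)%N /\ ucycle (adj F) p.

Definition cycle_edges (p : seq V) : {set {set V}} :=
  [set [set v; next p v] | v in p].

Definition hyper_adj (H : {set {set V}}) : rel V :=
  fun u v => [exists C in H, (u \in C) && (v \in C)].

Lemma hyper_adj_connect_sym (H : {set {set V}}) : connect_sym (hyper_adj H).
Proof.
apply: sym_connect_sym => u v; apply: eq_existsb => C.
by rewrite [(u \in C) && _]andbC.
Qed.

(* Vertices in no member of H count as components of their own. *)
Definition hyper_components (H : {set {set V}}) : nat :=
  n_comp (hyper_adj H) [set: V].

End EdgeSets.

(* Weights are only meaningful on the edges of the instance. *)
Record stars_nws (R : realType) (V : finType) := StarsNWS {
  edges : {set {set V}};
  edges_card2 : forall e, e \in edges -> #|e| = 2%N;
  communities : {set {set V}};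
  weight : {set V} -> R;
  weight_ge0 : forall e, e \in edges -> 0 <= weight e;
  edge_bound : int;
  weight_bound : R;
  weight_bound_gt0 : 0 < weight_bound
}.

Section Solutions.

Variables (R : realType) (V : finType) (I : stars_nws R V).

Definition solution (F : {set {set V}}) : Prop :=
  [/\ F \subset edges I,
      #|F|%:Z <= edge_bound I,
      \sum_(e in F) weight I e <= weight_bound I
    & forall C, C \in communities I -> univ F C != set0].

Definition yes_instance : Prop := exists F, solution F.

Definition optimal_solution (F : {set {set V}}) : Prop :=
  solution F /\ forall F', solution F' -> (#|F| <= #|F'|)%N.

Definition parameter : int :=
  edge_bound I - #|V|%:Z + (hyper_components (communities I))%:Z.

(* The edges of both stars lie within C1 :|: C2, so the cycles of the graph on
   C1 :|: C2 are those of the union of the two stars. *)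
Definition local_cycle (F : {set {set V}}) (p : seq V) : Prop :=
  exists C1 C2 : {set V}, exists c1 c2 : V,
    [/\ [/\ C1 \in communities I, C2 \in communities I & C1 <> C2],
        c1 \in univ F C1, c2 \in univ F C2
      & is_cycle (star c1 C1 :|: star c2 C2) p].

End Solutions.

(* Main.v *)
Require Import Defs.
From HB Require Import structures.
From mathcomp Require Import all_boot all_order all_algebra.
From mathcomp Require Import reals.
From mathcomp Require Import zify.

Set Implicit Arguments.
Unset Strict Implicit.
Unset Printing Implicit Defensive.

Import Order.TTheory GRing.Theory Num.Theory.
Local Open Scope ring_scope.

(** The members of a community are connected in [E'], so the cyclomatic number
    of [E'] is at most [t].  Take an edge set [U] of [E'] that is maximal subject
    to [#|U|] being at most four times the cyclomatic number of [U].  Adding to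
    [U] a cycle of length at most 4 that it does not contain would bring in at
    most four new edges and raise the cyclomatic number, since the last of the
    new edges closes a cycle; so [U] contains all these cycles.  Local cycles
    have length at most 4, because the two centers cover all edges of the two
    stars. *)

Section Components.

Variable T : finType.
Implicit Types (e : rel T) (x y u v : T).

Lemma set2_eq x y u v :
  [set x; y] = [set u; v] -> x = u /\ y = v \/ x = v /\ y = u.
Proof.
move=> xy_uv.
have : x \in [set u; v] by rewrite -xy_uv set21.
have : y \in [set u; v] by rewrite -xy_uv set22.
have : u \in [set x; y] by rewrite xy_uv set21.
have : v \in [set x; y] by rewrite xy_uv set22.
by move=> /set2P v_xy /set2P u_xy /set2P[] yE /set2P[] xE; subst; intuition.
Qed.

Lemma leq_imset_n_comp (S : finType) e (f : T -> S) :
    connect_sym e -> (forall x y, e x y -> f x = f y) ->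
  (#|f @: [set: T]| <= n_comp e [set: T])%N.
Proof.
move=> e_sym f_inv.
have f_root x : f x = f (fingraph.root e x).
  have fiber_closed : closed e [pred y | f y == f x].
    by move=> y z /f_inv; rewrite !inE => ->.
  have := closed_connect fiber_closed (connect_root e x).
  by rewrite !inE eqxx => /esym/eqP.
apply: leq_trans (leq_imset_card f _).
apply/subset_leq_card/subsetP => _ /imsetP[x _ ->].
by rewrite f_root imset_f // !inE (roots_root e_sym).
Qed.

Lemma leq_n_comp_subrel e e' :
    connect_sym e -> connect_sym e' -> subrel e (connect e') ->
  (n_comp e' [set: T] <= n_comp e [set: T])%N.
Proof.
move=> e_sym e'_sym ee'.
have root_inv x y : e x y -> fingraph.root e' x = fingraph.root e' y.
  by move=> /ee'/(fingraph.rootP e'_sym).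
apply: leq_trans (leq_imset_n_comp e_sym root_inv).
apply/subset_leq_card/subsetP => x; rewrite !inE andbT => /eqP <-.
exact: imset_f.
Qed.

Lemma leq_n_comp_add_pair e e' u v :
    connect_sym e -> connect_sym e' ->
    (forall x y, e' x y -> connect e x y \/ [set x; y] = [set u; v]) ->
  (n_comp e [set: T] <= (n_comp e' [set: T]).+1)%N.
Proof.
move=> e_sym e'_sym e'_pair; pose r := fingraph.root e.
pose glue x := if r x == r v then r u else r x.
have glue_uv : glue u = glue v by rewrite /glue eqxx; case: ifP.
have glue_inv x y : e' x y -> glue x = glue y.
  case/e'_pair=> [/(fingraph.rootP e_sym) rxy|]; first by rewrite /glue /r rxy.
  by case/set2_eq=> -[-> ->].
have roots_sub : [predI roots e & [set: T]] \subset r v |: glue @: [set: T].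
  apply/subsetP=> x; rewrite !inE andbT => /eqP rx.
  have [//|xrv] := eqVneq x (r v).
  by apply/imsetP; exists x; rewrite // /glue /r rx (negPf xrv).
apply: leq_trans (subset_leq_card roots_sub) _; rewrite cardsU1 -add1n.
exact: leq_add (leq_b1 _) (leq_imset_n_comp e'_sym glue_inv).
Qed.

End Components.

Section Cyclomatic.

Variable V : finType.
Implicit Types (F G : {set {set V}}) (e : {set V}).

Lemma adj_connect_sym F : connect_sym (adj F).
Proof. by apply: sym_connect_sym => u v; rewrite /adj eq_sym setUC. Qed.

Lemma adj_subset F G : F \subset G -> subrel (adj F) (adj G).
Proof. by move=> /subsetP FG u v /andP[uv /FG]; rewrite /adj uv. Qed.

Definition components F : nat := n_comp (adj F) [set: V].

Definition cyclomatic F : int := #|F|%:Z - #|V|%:Z + (components F)%:Z.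

Lemma components_setU1 F e : (components F <= (components (e |: F)).+1)%N.
Proof.
have adjU1 x y : adj (e |: F) x y -> connect (adj F) x y \/ [set x; y] = e.
  case/andP=> xy /setU1P[|xyF]; [by right | left].
  by rewrite connect1 // /adj xy.
have [/cards2P[u [v [_ e_uv]]]|e_n2] := boolP (#|e| == 2)%N.
  rewrite e_uv in adjU1 *.
  by apply: leq_n_comp_add_pair adjU1; apply: adj_connect_sym.
apply: leqW; apply: leq_n_comp_subrel; try exact: adj_connect_sym.
move=> x y e_xy; case/adjU1: (e_xy) => // xy_e; move: e_n2 e_xy.
by rewrite -xy_e cards2 /adj; case: (x != y).
Qed.

Lemma cyclomatic_set0_ge0 : 0 <= cyclomatic set0.
Proof.
have adj0_eq (x y : V) : adj set0 x y -> id x = id y by rewrite /adj inE andbF.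
have := leq_imset_n_comp (@adj_connect_sym set0) adj0_eq.
by rewrite imset_id cardsT /cyclomatic /components cards0; lia.
Qed.

Lemma le_cyclomatic_setU1 F e : cyclomatic F <= cyclomatic (e |: F).
Proof.
have [eF|eF] := boolP (e \in F); first by rewrite (setUidPr _) ?sub1set.
by have := components_setU1 F e; rewrite /cyclomatic cardsU1 eF; lia.
Qed.

Lemma le_cyclomatic_subset F G : F \subset G -> cyclomatic F <= cyclomatic G.
Proof.
move=> /setUidPl <-; rewrite -[G]set_enum.
elim: (enum G) => [|e s IHs]; first by rewrite set_nil set0U.
by rewrite set_cons -setUA (le_trans IHs) ?le_cyclomatic_setU1.
Qed.

End Cyclomatic.

Section Cycles.

Variable V : finType.
Implicit Types (F G U : {set {set V}}) (e S : {set V}) (p : seq V).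

Lemma is_cycle_subset F G p : F \subset G -> is_cycle F p -> is_cycle G p.
Proof.
move=> FG [p_size /andP[p_cycle p_uniq]]; split=> //.
by rewrite /ucycle p_uniq (sub_cycle (adj_subset FG)).
Qed.

Lemma cycle_edges_subset F p : is_cycle F p -> cycle_edges p \subset F.
Proof.
case=> _ /andP[p_cycle _]; apply/subsetP=> _ /imsetP[x xp ->].
by have /andP[] := next_cycle p_cycle xp.
Qed.

Lemma is_cycle_cycle_edges F p : is_cycle F p -> is_cycle (cycle_edges p) p.
Proof.
case=> p_size /andP[p_cycle p_uniq]; split=> //; rewrite /ucycle p_uniq andbT.
apply: cycle_from_next => // x xp; have /andP[x_next _] := next_cycle p_cycle xp.
by rewrite /adj x_next; apply: imset_f.
Qed.

Lemma card_cycle_edges p : (#|cycle_edges p| <= size p)%N.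
Proof. exact: leq_trans (leq_imset_card _ _) (card_size _). Qed.

Lemma path_adj_setD1 F e x y p :
    x \in e -> x \notin y :: p -> path (adj F) y p ->
  path (adj (F :\ e)) y p.
Proof.
move=> xe x_avoided; apply: (@sub_in_path _ (predC1 x)); last first.
  by apply/allP=> z zyp; apply: contraNneq x_avoided => <-.
move=> u v /negPf ux /negPf vx /andP[uv uvF]; rewrite /adj uv !inE uvF andbT.
by apply: contraTneq xe => <-; rewrite !inE eq_sym ux eq_sym vx.
Qed.

Lemma connect_cycle_setD1 F p x :
    is_cycle F p -> x \in p ->
  connect (adj (F :\ [set x; next p x])) (next p x) x.
Proof.
case=> p_size /andP[p_cycle p_uniq] xp.
have [i q pE] := rot_to xp; rewrite -(next_rot i p_uniq).
move: p_cycle p_uniq p_size.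
rewrite -(rot_cycle i) -(rot_uniq i) -(size_rot i) pE.
case: q {pE} => [|y [|z q]] //=; rewrite eqxx => /and3P[_ yz zq_path].
rewrite !inE !negb_or => /and4P[/and3P[xy xz xq] /andP[yz' yq] _ _] _.
(* The step from y to z avoids x and the rest of the way back to x avoids y, so
   neither uses the edge between x and y. *)
have yz_path : path (adj (F :\ [set x; y])) y [:: z].
  by apply: (path_adj_setD1 (set21 x y)); rewrite /= ?andbT // !inE negb_or xy.
have zx_path : path (adj (F :\ [set x; y])) z (rcons q x).
  apply: (path_adj_setD1 (set22 x y)) zq_path.
  by rewrite !inE mem_rcons inE !negb_or yz' eq_sym xy.
apply: (path_connect (p := z :: rcons q x)).
  by rewrite -cat1s cat_path yz_path.
by rewrite !inE mem_rcons mem_head !orbT.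
Qed.

Lemma components_cycle_setD1 F p e :
  is_cycle F p -> e \in cycle_edges p -> (components (F :\ e) <= components F)%N.
Proof.
move=> p_cycle /imsetP[x xp ->].
apply: leq_n_comp_subrel; try exact: adj_connect_sym.
move=> u v /andP[uv uvF]; have x_next := connect_cycle_setD1 p_cycle xp.
have [/set2_eq[] [-> ->] //|uv_e] := eqVneq [set u; v] [set x; next p x].
  by rewrite (adj_connect_sym _).
by apply: connect1; rewrite /adj uv !inE uv_e.
Qed.

Lemma lt_cyclomatic_setD1_cycle F p e :
  is_cycle F p -> e \in cycle_edges p -> cyclomatic (F :\ e) < cyclomatic F.
Proof.
move=> p_cycle ep; have eF := subsetP (cycle_edges_subset p_cycle) e ep.
rewrite /cyclomatic (cardsD1 e F) eF ltr_leD ?ltrD2r ?ltz_nat ?lez_nat //.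
exact: components_cycle_setD1 p_cycle ep.
Qed.

Lemma lt_cyclomatic_setU_cycle F U p :
    is_cycle F p -> ~~ (cycle_edges p \subset U) ->
  cyclomatic U < cyclomatic (U :|: cycle_edges p).
Proof.
move=> p_cycle /subsetPn[e ep eU]; set G := U :|: cycle_edges p.
have eG : e \in G by rewrite inE ep orbT.
have UG : U \subset G :\ e by rewrite subsetD1 subsetUl.
have G_cycle : is_cycle G p.
  exact: is_cycle_subset (subsetUr _ _) (is_cycle_cycle_edges p_cycle).
apply: le_lt_trans (le_cyclomatic_subset UG) _.
exact: lt_cyclomatic_setD1_cycle G_cycle ep.
Qed.

Lemma short_cycles_cover F (k : nat) :
  exists U : {set {set V}},
    [/\ U \subset F,
        #|U|%:Z <= k%:Z * cyclomatic F
      & forall p, is_cycle F p -> (size p <= k)%N -> cycle_edges p \subset U].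
Proof.
pose sparse U := (U \subset F) && (#|U|%:Z <= k%:Z * cyclomatic U).
have sparse0 : sparse set0.
  by rewrite /sparse sub0set cards0 mulr_ge0 ?cyclomatic_set0_ge0.
have [U /maxsetP[/andP[UF U_sparse] U_max] _] := maxset_exists sparse0.
exists U; split=> // [|p p_cycle p_size].
  exact: le_trans U_sparse (ler_wpM2l _ (le_cyclomatic_subset UF)).
apply/negPn/negP => pU; have lt_cyc := lt_cyclomatic_setU_cycle p_cycle pU.
suff U_eq : U :|: cycle_edges p = U by rewrite U_eq ltxx in lt_cyc.
apply: U_max (subsetUl _ _); rewrite /sparse subUset UF cycle_edges_subset //=.
have card_le : #|U :|: cycle_edges p|%:Z <= #|U|%:Z + k%:Z.
  rewrite lez_nat (leq_trans (leq_card_setU _ _)) // leq_add2l.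
  exact: leq_trans (card_cycle_edges p) p_size.
apply: le_trans card_le _.
apply: (@le_trans _ _ (k%:Z * (cyclomatic U + 1))).
  by rewrite mulrDr mulr1 lerD2r.
by rewrite ler_wpM2l // lezD1.
Qed.

Lemma size_cycle_vertex_cover F S p :
    (forall e, e \in F -> S :&: e != set0) -> is_cycle F p ->
  (size p <= 2 * #|S|)%N.
Proof.
move=> F_cover p_cycle; have [_ /andP[_ p_uniq]] := p_cycle.
have <- : size (enum S ++ map (prev p) (enum S)) = (2 * #|S|)%N.
  by rewrite size_cat size_map -cardE addnn mul2n.
apply: uniq_leq_size => // x xp; rewrite mem_cat mem_enum.
have /F_cover/set0Pn[s] : [set x; next p x] \in F.
  by apply: (subsetP (cycle_edges_subset p_cycle)); apply: imset_f.
case/setIP=> sS /set2P[<-|s_next]; first by rewrite sS.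
by apply/orP; right; rewrite -(prev_next p_uniq x) -s_next map_f ?mem_enum.
Qed.

End Cycles.

Section Stars.

Variable V : finType.
Implicit Types (F : {set {set V}}) (C : {set V}) (c : V).

Lemma star_subset F C c : c \in univ F C -> star c C \subset F.
Proof.
rewrite inE => /andP[_ /forall_inP c_univ].
by apply/subsetP=> _ /imsetP[w wC ->]; case/andP: (c_univ w wC).
Qed.

Lemma connect_univ F C :
  univ F C != set0 -> {in C &, forall u v, connect (adj F) u v}.
Proof.
case/set0Pn=> c; rewrite inE => /andP[_ /forall_inP c_univ].
have c_connect w : w \in C -> connect (adj F) c w.
  move=> wC; have [->|wc] := eqVneq w c; first exact: connect0.
  by apply/connect1/c_univ; rewrite !inE wc.
move=> u v uC vC; apply: connect_trans (c_connect v vC).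
by rewrite (adj_connect_sym _) c_connect.
Qed.

End Stars.

Section Solutions.

Variables (R : realType) (V : finType) (I : stars_nws R V).
Implicit Types (F : {set {set V}}) (p : seq V).

Lemma cyclomatic_le_parameter F : solution I F -> cyclomatic F <= parameter I.
Proof.
case=> _ F_card _ F_univ.
have : (components F <= hyper_components (communities I))%N.
  apply: leq_n_comp_subrel; [exact: hyper_adj_connect_sym | exact: adj_connect_sym |].
  move=> u v /exists_inP[C /F_univ/connect_univ C_connect /andP[uC vC]].
  exact: C_connect.
by rewrite /cyclomatic /parameter; lia.
Qed.

Lemma local_cycle_is_cycle F p : local_cycle I F p -> is_cycle F p.
Proof.
case=> C1 [C2 [c1 [c2 [_ c1_univ c2_univ]]]]; apply: is_cycle_subset.
by rewrite subUset !star_subset.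
Qed.

Lemma size_local_cycle F p : local_cycle I F p -> (size p <= 4)%N.
Proof.
case=> C1 [C2 [c1 [c2 [_ _ _ p_cycle]]]].
have centers_cover e :
    e \in star c1 C1 :|: star c2 C2 -> [set c1; c2] :&: e != set0.
  case/setUP=> /imsetP[w _ ->]; apply/set0Pn; [exists c1 | exists c2].
    by rewrite !inE !eqxx.
  by rewrite !inE !eqxx orbT.
apply: leq_trans (size_cycle_vertex_cover centers_cover p_cycle) _.
by rewrite cards2; case: (c1 != c2).
Qed.

End Solutions.

Theorem lemma18 (R : realType) (V : finType) (I : stars_nws R V)
    (Iyes : yes_instance I) (E' : {set {set V}})
    (E'opt : optimal_solution I E') :
  exists Estar : {set {set V}},
    [/\ Estar \subset E',
        #|Estar|%:Z <= 4 * parameter I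
      & forall p : seq V, local_cycle I E' p -> cycle_edges p \subset Estar].
Proof.
have [E'sol _] := E'opt.
have [U [UE' U_le U_cycles]] := short_cycles_cover E' 4.
exists U; split=> // [|p p_local].
  by apply: le_trans U_le _; rewrite ler_wpM2l ?cyclomatic_le_parameter.
exact: U_cycles (local_cycle_is_cycle p_local) (size_local_cycle p_local).
Qed.
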